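(* Let $\mathcal{T}$ be a triangulated category with 4-periodical semi-orthogonal decompositions $$\mathcal{T}=\langle\mathcal{A},\mathcal{B}\rangle=\langle\mathcal{B},\mathcal{C}\rangle=\langle\mathcal{C},\mathcal{D}\rangle=\langle\mathcal{D},\mathcal{A}\rangle.$$ Then the pairs $(\mathcal{A},\mathcal{C})$ and $(\mathcal{B},\mathcal{D})$ of subcategories of $\mathcal{T}$ are spherical pairs.
   Context: Convention: in a semi-orthogonal decomposition $\mathcal{T}=\langle\mathcal{A},\mathcal{B}\rangle$ one has $\mathrm{Hom}(\mathcal{B},\mathcal{A})=0$, and each object $T$ fits into an exact triangle $B\to T\to A\to B[1]$ with $A\in\mathcal{A}$, $B\in\mathcal{B}$. The left orthogonal of $\mathcal{A}$ is ${}^\perp\mathcal{A}=\{T\mid\mathrm{Hom}(T,\mathcal{A})=0\}$. Let $\mathcal{E}_+,\mathcal{E}_-$ be admissible subcategories of a triangulated category $\mathcal{E}$ (full triangulated subcategories whose inclusions $i_\pm\colon\mathcal{E}_\pm\to\mathcal{E}$ have left adjoints $i_\pm^*$ and right adjoints $i_\pm^!$). Let $j_\pm\colon{}^\perp\mathcal{E}_\pm\to\mathcal{E}$ be the inclusions of the left orthogonals and $j_\pm^!$ their right adjoints. The pair $(\mathcal{E}_+,\mathcal{E}_-)$ is a spherical pair if (1) the composites $i_+^*i_-\colon\mathcal{E}_-\to\mathcal{E}_+$ and $i_-^*i_+\colon\mathcal{E}_+\to\mathcal{E}_-$ are equivalences, and (2) the composites $j_+^!j_-\colon{}^\perp\mathcal{E}_-\to{}^\perp\mathcal{E}_+$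 and $j_-^!j_+\colon{}^\perp\mathcal{E}_+\to{}^\perp\mathcal{E}_-$ are equivalences. (The paper assumes throughout that these inclusions and adjoints are induced by appropriate DG functors.) *)

(* Defs.v *)
From mathcomp Require Import all_boot all_algebra.

Set Implicit Arguments.
Unset Strict Implicit.
Unset Printing Implicit Defensive.

Import GRing.Theory.
Local Open Scope ring_scope.

(* Morphisms compose in the usual order: [comp g f] is "f, then g".            *)
Record preadditive_category := PreadditiveCategory {
  object :> Type;
  hom : object -> object -> zmodType;
  idm : forall X, hom X X;
  comp : forall X Y Z, hom Y Z -> hom X Y -> hom X Z;
  compA : forall X Y Z W (h : hom Z W) (g : hom Y Z) (f : hom X Y),
    comp h (comp g f) = comp (comp h g) f;
  comp1m : forall X Y (f : hom X Y), comp (idm Y) f = f;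
  compm1 : forall X Y (f : hom X Y), comp f (idm X) = f;
  compDl : forall X Y Z (g1 g2 : hom Y Z) (f : hom X Y),
    comp (g1 + g2) f = comp g1 f + comp g2 f;
  compDr : forall X Y Z (g : hom Y Z) (f1 f2 : hom X Y),
    comp g (f1 + f2) = comp g f1 + comp g f2
}.

Arguments hom {p} _ _.
Arguments idm {p} X.
Arguments comp {p X Y Z} g f.

Notation "g \oc f" := (comp g f) (at level 40, left associativity).

Definition is_iso (C : preadditive_category) (X Y : C) (f : hom X Y) : Prop :=
  exists g : hom Y X, g \oc f = idm X /\ f \oc g = idm Y.

(* Initial and terminal.                                                       *)
Definition is_zero_object (C : preadditive_category) (Z : C) : Prop :=
  forall X : C, (forall f : hom X Z, f = 0) /\ (forall f : hom Z X, f = 0).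

Definition is_biproduct (C : preadditive_category) (X Y S : C)
    (iX : hom X S) (iY : hom Y S) (pX : hom S X) (pY : hom S Y) : Prop :=
  [/\ pX \oc iX = idm X, pY \oc iY = idm Y, pX \oc iY = 0, pY \oc iX = 0
    & iX \oc pX + iY \oc pY = idm S].

Record additive_category := AdditiveCategory {
  preadditive_of :> preadditive_category;
  has_zero_object : exists Z : preadditive_of, is_zero_object Z;
  has_biproducts : forall X Y : preadditive_of,
    exists (S : preadditive_of) (iX : hom X S) (iY : hom Y S)
           (pX : hom S X) (pY : hom S Y), is_biproduct iX iY pX pY
}.

(* All functors in this file are additive.                                     *)
Record functor (C D : preadditive_category) := Functor {
  fobj :> C -> D;
  fmap : forall X Y : C, hom X Y -> hom (fobj X) (fobj Y);
  fmap1 : forall X : C, fmap (idm X) = idm (fobj X);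
  fmap_comp : forall (X Y Z : C) (g : hom Y Z) (f : hom X Y),
    fmap (g \oc f) = fmap g \oc fmap f;
  fmapD : forall (X Y : C) (f g : hom X Y), fmap (f + g) = fmap f + fmap g
}.

Arguments fmap {C D} F {X Y} f : rename.

Definition functor_id (C : preadditive_category) : functor C C.
Proof. by exists (fun X => X) (fun X Y f => f). Defined.

Definition functor_comp (C D E : preadditive_category)
  (G : functor D E) (F : functor C D) : functor C E.
Proof.
exists (fun X => G (F X)) (fun X Y f => fmap G (fmap F f)).
- by move=> X; rewrite !fmap1.
- by move=> X Y Z g f; rewrite !fmap_comp.
- by move=> X Y f g; rewrite !fmapD.
Defined.

Definition naturally_isomorphic (C D : preadditive_category)
    (F G : functor C D) : Prop :=
  exists t : forall X : C, hom (F X) (G X),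
    (forall X, is_iso (t X)) /\
    (forall (X Y : C) (f : hom X Y), t Y \oc fmap F f = fmap G f \oc t X).

Definition is_equivalence (C D : preadditive_category) (F : functor C D) : Prop :=
  exists G : functor D C,
    naturally_isomorphic (functor_comp G F) (functor_id C) /\
    naturally_isomorphic (functor_comp F G) (functor_id D).

(* [adjoint F G]: F is left adjoint to G, i.e. there is a bijection            *)
(* Hom(F X, Y) -> Hom(X, G Y), natural in X and Y.                             *)
Definition adjoint (C D : preadditive_category)
    (F : functor C D) (G : functor D C) : Prop :=
  exists phi : forall (X : C) (Y : D), hom (F X) Y -> hom X (G Y),
    [/\ forall X Y, bijective (phi X Y),
        forall (X X' : C) (Y : D) (a : hom X' X) (u : hom (F X) Y),
          phi X' Y (u \oc fmap F a) = phi X Y u \oc a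
      & forall (X : C) (Y Y' : D) (b : hom Y Y') (u : hom (F X) Y),
          phi X Y' (b \oc u) = fmap G b \oc phi X Y u].

Definition full_subcategory (C : preadditive_category) (P : C -> Prop) :
  preadditive_category.
Proof.
exists {X : C | P X} (fun X Y => hom (sval X) (sval Y))
  (fun X => idm (sval X)) (fun X Y Z g f => g \oc f).
- by move=> *; apply: compA.
- by move=> *; apply: comp1m.
- by move=> *; apply: compm1.
- by move=> *; apply: compDl.
- by move=> *; apply: compDr.
Defined.

Definition inclusion (C : preadditive_category) (P : C -> Prop) :
  functor (full_subcategory P) C.
Proof.
by exists (fun X : full_subcategory P => sval X) (fun X Y f => f).
Defined.

(* The shift [1] is only required to be an autoequivalence, not an             *)
(* automorphism.  [dist f g h] says that X -f-> Y -g-> Z -h-> X[1] is an exact *)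
(* (distinguished) triangle.                                                   *)
Record triangulated_category := TriangulatedCategory {
  additive_of :> additive_category;
  shift : functor additive_of additive_of;
  shift_equivalence : is_equivalence shift;
  dist : forall X Y Z : additive_of,
    hom X Y -> hom Y Z -> hom Z (shift X) -> Prop;
  (* TR1 *)
  dist_iso : forall (X Y Z X' Y' Z' : additive_of)
      (f : hom X Y) (g : hom Y Z) (h : hom Z (shift X))
      (f' : hom X' Y') (g' : hom Y' Z') (h' : hom Z' (shift X'))
      (a : hom X X') (b : hom Y Y') (c : hom Z Z'),
    is_iso a -> is_iso b -> is_iso c ->
    b \oc f = f' \oc a -> c \oc g = g' \oc b -> fmap shift a \oc h = h' \oc c ->
    dist f g h -> dist f' g' h';
  dist_id : forall X Z : additive_of, is_zero_object Z ->
    dist (idm X) (0 : hom X Z) (0 : hom Z (shift X));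
  dist_complete : forall (X Y : additive_of) (f : hom X Y),
    exists (Z : additive_of) (g : hom Y Z) (h : hom Z (shift X)), dist f g h;
  (* TR2 *)
  dist_rotate : forall (X Y Z : additive_of)
      (f : hom X Y) (g : hom Y Z) (h : hom Z (shift X)),
    dist f g h <-> dist g h (- fmap shift f);
  (* TR3 *)
  dist_fill : forall (X Y Z X' Y' Z' : additive_of)
      (f : hom X Y) (g : hom Y Z) (h : hom Z (shift X))
      (f' : hom X' Y') (g' : hom Y' Z') (h' : hom Z' (shift X'))
      (a : hom X X') (b : hom Y Y'),
    dist f g h -> dist f' g' h' -> b \oc f = f' \oc a ->
    exists c : hom Z Z', c \oc g = g' \oc b /\ fmap shift a \oc h = h' \oc c;
  (* TR4, the octahedral axiom *)
  dist_octahedron : forall (X Y Z U V W : additive_of)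
      (f : hom X Y) (f1 : hom Y U) (f2 : hom U (shift X))
      (g : hom Y Z) (g1 : hom Z W) (g2 : hom W (shift Y))
      (h1 : hom Z V) (h2 : hom V (shift X)),
    dist f f1 f2 -> dist g g1 g2 -> dist (g \oc f) h1 h2 ->
    exists (u : hom U V) (v : hom V W),
      dist u v (fmap shift f1 \oc g2) /\
      [/\ u \oc f1 = h1 \oc g, h2 \oc u = f2, v \oc h1 = g1
        & g2 \oc v = fmap shift f \oc h2]
}.

Arguments shift {t}.
Arguments dist {t X Y Z} f g h.

(* A full subcategory is given by its class of objects P.  Closure under       *)
(* isomorphism follows from the other conditions: an isomorphism X -> Y        *)
(* completes to a triangle X -> Y -> 0 -> X[1], which can be rotated.          *)
Record is_triangulated_subcategory (T : triangulated_category)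
    (P : T -> Prop) : Prop := {
  sub_zero : exists Z : T, is_zero_object Z /\ P Z;
  sub_shift : forall X : T, P X <-> P (shift X);
  sub_cone : forall (X Y Z : T) (f : hom X Y) (g : hom Y Z) (h : hom Z (shift X)),
    dist f g h -> P X -> P Y -> P Z
}.

Definition left_orthogonal (T : triangulated_category) (A : T -> Prop) : T -> Prop :=
  fun X => forall Y : T, A Y -> forall f : hom X Y, f = 0.

(* T = <A, B>, with Hom(B, A) = 0.                                             *)
Record semiorthogonal_decomposition (T : triangulated_category)
    (A B : T -> Prop) : Prop := {
  sod_left : is_triangulated_subcategory A;
  sod_right : is_triangulated_subcategory B;
  sod_orthogonal : forall X Y : T, B X -> A Y -> forall f : hom X Y, f = 0;
  sod_triangle : forall X : T,
    exists (Y Z : T) (f : hom Y X) (g : hom X Z) (h : hom Z (shift Y)),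
      [/\ B Y, A Z & dist f g h]
}.

Definition has_left_adjoint (C D : preadditive_category) (F : functor C D) : Prop :=
  exists L : functor D C, adjoint L F.

Definition has_right_adjoint (C D : preadditive_category) (F : functor C D) : Prop :=
  exists R : functor D C, adjoint F R.

Record admissible (T : triangulated_category) (P : T -> Prop) : Prop := {
  adm_triangulated : is_triangulated_subcategory P;
  adm_left : has_left_adjoint (inclusion P);
  adm_right : has_right_adjoint (inclusion P)
}.

(* The composite L i_N for a left adjoint L of i_M, and the composite R j_N    *)
(* for a right adjoint R of j_M.  Adjoints are unique up to isomorphism, so    *)
(* the choice of L and R is immaterial; their existence is part of             *)
(* [spherical_pair].                                                           *)
Definition left_composite_equivalence (T : triangulated_category)
    (M N : T -> Prop) : Prop :=
  forall L : functor T (full_subcategory M), adjoint L (inclusion M) ->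
    is_equivalence (functor_comp L (inclusion N)).

Definition right_composite_equivalence (T : triangulated_category)
    (M N : T -> Prop) : Prop :=
  forall R : functor T (full_subcategory M), adjoint (inclusion M) R ->
    is_equivalence (functor_comp R (inclusion N)).

Record spherical_pair (T : triangulated_category) (Ep Em : T -> Prop) : Prop := {
  sph_admissible_p : admissible Ep;
  sph_admissible_m : admissible Em;
  sph_right_adjoint_p : has_right_adjoint (inclusion (left_orthogonal Ep));
  sph_right_adjoint_m : has_right_adjoint (inclusion (left_orthogonal Em));
  sph_left_pm : left_composite_equivalence Ep Em;
  sph_left_mp : left_composite_equivalence Em Ep;
  sph_right_pm :
    right_composite_equivalence (left_orthogonal Ep) (left_orthogonal Em);
  sph_right_mp :
    right_composite_equivalence (left_orthogonal Em) (left_orthogonal Ep)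
}.

(* Main.v *)
From mathcomp Require Import all_boot all_algebra.
From mathcomp Require Import boolp.
Require Import Defs.


(** The proof rests on mutation. Given two adjacent decompositions
    T = <P, Q> = <Q, S>, consider the arrows s -> p with s in S, p in P and
    cone in Q. Since Hom(S, Q) = 0, such an arrow is a universal arrow from
    S to p; since Hom(Q, P) = 0, it is also a universal arrow from s to P
    ([mutation_correspondence]). Every s in S is the source of one, by the
    triangle of <P, Q>, and every p in P is the target of one, by the triangle
    of <Q, S>. A family of doubly universal arrows with these two properties
    identifies S with P, and the equivalence is s |-> (left adjoint of the
    inclusion of P)(s) in one direction and p |-> (right adjoint of the
    inclusion of S)(p) in the other ([correspondence_left_equivalence],
    [correspondence_right_equivalence]).

    In a decomposition T = <P, Q> the left orthogonal of P is Q
    ([sod_left_orthogonal]), so for the pair (A, C) the two left orthogonals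
    are B and D. The four composites in the definition of a spherical pair are
    then mutations: left adjoints for the chains A, B, C and C, D, A, and
    right adjoints for D, A, B and B, C, D. The hypotheses are invariant under
    cyclic rotation, and rotating once turns (A, C) into (B, D). *)

Set Implicit Arguments.
Unset Strict Implicit.
Unset Printing Implicit Defensive.

Import GRing.Theory.
Local Open Scope ring_scope.

Lemma inj_surj_bij (U V : Type) (f : U -> V) :
  injective f -> (forall y, exists x, f x = y) -> bijective f.
Proof.
move=> inj_f surj_f; exists (fun y => projT1 (cid (surj_f y))) => z.
  by apply: inj_f; case: cid.
by case: cid.
Qed.

Lemma bij_cancel (U V W : Type) (f : U -> V) (g : V -> W) (h : U -> W) :
  bijective g -> bijective h -> (forall x, g (f x) = h x) -> bijective f.
Proof.
move=> [g' gK g'K] bij_h gfE; apply: (@eq_bij _ _ (g' \o h)).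
  by apply: bij_comp bij_h; exists g.
by move=> x /=; rewrite -gfE gK.
Qed.

(** * Preadditive categories and equivalences *)

Section Preadditive.

Variables C D : preadditive_category.

Lemma comp0m (X Y Z : C) (f : hom X Y) : (0 : hom Y Z) \oc f = 0.
Proof. by apply: (addrI ((0 : hom Y Z) \oc f)); rewrite -compDl !addr0. Qed.

Lemma compm0 (X Y Z : C) (g : hom Y Z) : g \oc (0 : hom X Y) = 0.
Proof. by apply: (addrI (g \oc (0 : hom X Y))); rewrite -compDr !addr0. Qed.

Lemma compNm (X Y Z : C) (g : hom Y Z) (f : hom X Y) : (- g) \oc f = - (g \oc f).
Proof. by apply: (addrI (g \oc f)); rewrite -compDl !subrr comp0m. Qed.

Lemma compmN (X Y Z : C) (g : hom Y Z) (f : hom X Y) : g \oc (- f) = - (g \oc f).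
Proof. by apply: (addrI (g \oc f)); rewrite -compDr !subrr compm0. Qed.

Lemma fmap0 (F : functor C D) (X Y : C) : fmap F (0 : hom X Y) = 0.
Proof. by apply: (addrI (fmap F (0 : hom X Y))); rewrite -fmapD !addr0. Qed.

Lemma fmapN (F : functor C D) (X Y : C) (f : hom X Y) : fmap F (- f) = - fmap F f.
Proof. by apply: (addrI (fmap F f)); rewrite -fmapD !subrr fmap0. Qed.

Lemma zero_object_eq (Z X : C) (f g : hom Z X) : is_zero_object Z -> f = g.
Proof. by move=> /(_ X)[_ z]; rewrite (z f) (z g). Qed.

Lemma is_iso_epi (X Y Z : C) (f : hom X Y) (u v : hom Y Z) :
  is_iso f -> u \oc f = v \oc f -> u = v.
Proof.
move=> [g [_ fg]] /(congr1 (fun w => w \oc g)).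
by rewrite -!compA fg !compm1.
Qed.

Lemma is_iso_mono (X Y Z : C) (f : hom X Y) (u v : hom Z X) :
  is_iso f -> f \oc u = f \oc v -> u = v.
Proof.
move=> [g [gf _]] /(congr1 (fun w => g \oc w)).
by rewrite !compA gf !comp1m.
Qed.

Lemma equivalence_faithful (F : functor C D) (X Y : C) :
  is_equivalence F -> injective (@fmap _ _ F X Y).
Proof.
move=> [G [[t [iso_t t_nat]] _]] u v Fuv.
apply: (is_iso_epi (iso_t X)).
by move: (t_nat _ _ u) (t_nat _ _ v) => /= <- <-; rewrite Fuv.
Qed.

End Preadditive.

(** Exchanging the roles of the functors turns fullness of [F] into faithfulness
    of its quasi-inverse. *)
Lemma equivalence_sym (C D : preadditive_category) (F : functor C D) :
  is_equivalence F -> exists2 G : functor D C, is_equivalence G &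
    naturally_isomorphic (functor_comp G F) (functor_id C).
Proof. by move=> [G [GF FG]]; exists G => //; exists F. Qed.

Lemma equivalence_full (C D : preadditive_category) (F : functor C D) (X Y : C) :
  is_equivalence F -> forall v : hom (F X) (F Y), exists u, fmap F u = v.
Proof.
move=> /equivalence_sym[G eqG [t [iso_t t_nat]]] v.
have [s [ts st]] := iso_t X.
exists (t Y \oc fmap G v \oc s).
apply: (equivalence_faithful eqG); apply: (is_iso_mono (iso_t Y)).
have /= -> := t_nat _ _ (t Y \oc fmap G v \oc s).
by rewrite -compA ts compm1.
Qed.

(** The quasi-inverse is chosen object by object, together with isomorphisms
    [t Y : F (g Y) -> Y]; full faithfulness then lifts the conjugate of an arrow
    by these isomorphisms, and injectivity on arrows makes the lift functorial. *)
Lemma fully_faithful_equivalence (C D : preadditive_category) (F : functor C D) :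
  (forall X Y, bijective (@fmap _ _ F X Y)) ->
  (forall Y, exists X (t : hom (F X) Y), is_iso t) ->
  is_equivalence F.
Proof.
move=> ffF esoF.
pose g Y := projT1 (cid (esoF Y)).
pose t Y : hom (F (g Y)) Y := projT1 (cid (projT2 (cid (esoF Y)))).
have iso_t Y : is_iso (t Y) := projT2 (cid (projT2 (cid (esoF Y)))).
pose s Y := projT1 (cid (iso_t Y)).
have st Y : s Y \oc t Y = idm _ := (projT2 (cid (iso_t Y))).1.
have ts Y : t Y \oc s Y = idm _ := (projT2 (cid (iso_t Y))).2.
have injF X Y : injective (@fmap _ _ F X Y) := bij_inj (ffF X Y).
have surjF X Y (v : hom (F X) (F Y)) : exists u, fmap F u = v.
  by have [F' _ FK] := ffF X Y; exists (F' v).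
pose lift X Y (v : hom (F X) (F Y)) : hom X Y := projT1 (cid (surjF _ _ v)).
have liftK X Y (v : hom (F X) (F Y)) : fmap F (lift _ _ v) = v.
  by rewrite /lift; case: cid.
pose gm Y Y' (u : hom Y Y') : hom (g Y) (g Y') := lift _ _ (s Y' \oc u \oc t Y).
have gmE Y Y' (u : hom Y Y') : fmap F (gm _ _ u) = s Y' \oc u \oc t Y.
  exact: liftK.
have gm1 Y : gm _ _ (idm Y) = idm (g Y).
  by apply: injF; rewrite gmE compm1 st fmap1.
have gm_comp X Y Z (v : hom Y Z) (u : hom X Y) :
    gm _ _ (v \oc u) = gm _ _ v \oc gm _ _ u.
  apply: injF; rewrite fmap_comp !gmE -!compA; congr (_ \oc (_ \oc _)).
  by rewrite (compA (t Y)) ts comp1m.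
have gmD X Y (u v : hom X Y) : gm _ _ (u + v) = gm _ _ u + gm _ _ v.
  by apply: injF; rewrite fmapD !gmE compDr compDl.
exists (Functor gm1 gm_comp gmD); split.
  exists (fun X => lift _ _ (t (F X))); split=> [X|X Y f] /=.
    exists (lift _ _ (s (F X))).
    by split; apply: injF; rewrite fmap_comp !liftK fmap1.
  by apply: injF; rewrite !fmap_comp !liftK !compA ts comp1m.
exists t; split=> // X Y f /=.
by rewrite gmE !compA ts comp1m.
Qed.

(** * Reflections and coreflections *)

Section Reflections.

Variables (C : preadditive_category).
Implicit Types P S : C -> Prop.

Definition is_reflection P (X Y : C) (f : hom X Y) : Prop :=
  P Y /\ forall W, P W -> bijective (fun u : hom Y W => u \oc f).

Definition is_coreflection S (X Y : C) (f : hom X Y) : Prop :=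
  S X /\ forall W, S W -> bijective (fun u : hom W X => f \oc u).

Lemma reflection_unique P (X Y Y' : C) (f : hom X Y) (f' : hom X Y') :
  is_reflection P f -> is_reflection P f' ->
  exists2 s : hom Y Y', is_iso s & s \oc f = f'.
Proof.
move=> [PY bf] [PY' bf'].
have [e _ eK] := bf _ PY'; have [e' _ e'K] := bf' _ PY.
exists (e f'); last exact: eK.
exists (e' f); split.
  by apply: (bij_inj (bf _ PY)); rewrite /= -compA eK e'K comp1m.
by apply: (bij_inj (bf' _ PY')); rewrite /= -compA e'K eK comp1m.
Qed.

Lemma coreflection_unique S (X X' Y : C) (f : hom X Y) (f' : hom X' Y) :
  is_coreflection S f -> is_coreflection S f' ->
  exists2 s : hom X X', is_iso s & f' \oc s = f.
Proof.
move=> [SX bf] [SX' bf'].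
have [e _ eK] := bf' _ SX; have [e' _ e'K] := bf _ SX'.
exists (e f); last exact: eK.
exists (e' f'); split.
  by apply: (bij_inj (bf _ SX)); rewrite /= compA e'K eK compm1.
by apply: (bij_inj (bf' _ SX')); rewrite /= compA eK e'K compm1.
Qed.

Lemma iso_precomp_bij (X Y W : C) (s : hom X Y) :
  is_iso s -> bijective (fun u : hom Y W => u \oc s).
Proof.
move=> [r [rs sr]]; exists (fun u => u \oc r) => u.
  by rewrite -compA sr compm1.
by rewrite -compA rs compm1.
Qed.

Lemma iso_postcomp_bij (X Y W : C) (s : hom X Y) :
  is_iso s -> bijective (fun u : hom W X => s \oc u).
Proof.
move=> [r [rs sr]]; exists (fun u => r \oc u) => u.
  by rewrite compA rs comp1m.
by rewrite compA sr comp1m.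
Qed.

(** The usual pointwise criterion: choose a universal arrow [e X] from each [X]
    and let the functor send [u] to the only arrow compatible with the [e X]. *)
Lemma reflections_left_adjoint P :
  (forall X, exists Y (f : hom X Y), is_reflection P f) ->
  has_left_adjoint (inclusion P).
Proof.
move=> refl.
pose l X := projT1 (cid (refl X)).
pose e X : hom X (l X) := projT1 (cid (projT2 (cid (refl X)))).
have le X : is_reflection P (e X) := projT2 (cid (projT2 (cid (refl X)))).
have inj_e X W (PW : P W) : injective (fun u : hom (l X) W => u \oc e X).
  exact: bij_inj ((le X).2 _ PW).
have surj_e X X' (u : hom X X') : exists v : hom (l X) (l X'),
    v \oc e X = e X' \oc u.
  by have [e' _ eK] := (le X).2 _ (le X').1; exists (e' (e X' \oc u)); exact: eK.
pose lo X : full_subcategory P := exist P (l X) (le X).1.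
pose lm X X' (u : hom X X') : hom (lo X) (lo X') := projT1 (cid (surj_e _ _ u)).
have lmE X X' (u : hom X X') : (lm _ _ u : hom (l X) (l X')) \oc e X = e X' \oc u.
  exact: projT2 (cid (surj_e _ _ u)).
have lm1 X : lm _ _ (idm X) = idm (lo X).
  by apply: (inj_e _ _ (le X).1); rewrite /= lmE compm1 comp1m.
have lm_comp X Y Z (v : hom Y Z) (u : hom X Y) :
    lm _ _ (v \oc u) = lm _ _ v \oc lm _ _ u.
  apply: (inj_e _ _ (le Z).1); rewrite /= lmE.
  by rewrite -[RHS]compA lmE [RHS]compA lmE compA.
have lmD X Y (u v : hom X Y) : lm _ _ (u + v) = lm _ _ u + lm _ _ v.
  apply: (inj_e _ _ (le Y).1); rewrite /= lmE.
  by rewrite [RHS]compDl !lmE compDr.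
exists (Functor lm1 lm_comp lmD).
exists (fun X (Y : full_subcategory P) (u : hom (l X) (sval Y)) => u \oc e X).
split=> [X Y|X X' Y a u|X Y Y' b u] /=.
- exact: (le X).2 _ (svalP Y).
- by rewrite -[RHS]compA -lmE [RHS]compA.
- by rewrite compA.
Qed.

Lemma coreflections_right_adjoint S :
  (forall Y, exists X (f : hom X Y), is_coreflection S f) ->
  has_right_adjoint (inclusion S).
Proof.
move=> corefl.
pose r Y := projT1 (cid (corefl Y)).
pose e Y : hom (r Y) Y := projT1 (cid (projT2 (cid (corefl Y)))).
have re Y : is_coreflection S (e Y) := projT2 (cid (projT2 (cid (corefl Y)))).
have inj_e Y W (SW : S W) : injective (fun u : hom W (r Y) => e Y \oc u).
  exact: bij_inj ((re Y).2 _ SW).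
have surj_e W Y (SW : S W) (u : hom W Y) : exists v : hom W (r Y), e Y \oc v = u.
  by have [e' _ eK] := (re Y).2 _ SW; exists (e' u); exact: eK.
pose ro Y : full_subcategory S := exist S (r Y) (re Y).1.
pose adj (X : full_subcategory S) Y (u : hom (sval X) Y) : hom X (ro Y) :=
  projT1 (cid (surj_e _ _ (svalP X) u)).
have adjE (X : full_subcategory S) Y (u : hom (sval X) Y) :
    e Y \oc (adj X Y u : hom (sval X) (r Y)) = u.
  exact: projT2 (cid (surj_e _ _ (svalP X) u)).
pose rm Y Y' (u : hom Y Y') : hom (ro Y) (ro Y') := adj (ro Y) Y' (u \oc e Y).
have rmE Y Y' (u : hom Y Y') : e Y' \oc (rm _ _ u : hom (r Y) (r Y')) = u \oc e Y.
  exact: (adjE (ro Y)).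
have rm1 Y : rm _ _ (idm Y) = idm (ro Y).
  by apply: (inj_e _ _ (re Y).1); rewrite /= rmE compm1 comp1m.
have rm_comp X Y Z (v : hom Y Z) (u : hom X Y) :
    rm _ _ (v \oc u) = rm _ _ v \oc rm _ _ u.
  apply: (inj_e _ _ (re X).1); rewrite /= rmE.
  by rewrite [RHS]compA rmE -[RHS]compA rmE compA.
have rmD X Y (u v : hom X Y) : rm _ _ (u + v) = rm _ _ u + rm _ _ v.
  apply: (inj_e _ _ (re X).1); rewrite /= rmE.
  by rewrite [RHS]compDr !rmE compDl.
exists (Functor rm1 rm_comp rmD).
exists adj; split=> [X Y|X X' Y a u|X Y Y' b u] /=.
- exists (fun v : hom (sval X) (r Y) => e Y \oc v) => v; first exact: adjE.
  by apply: (inj_e _ _ (svalP X)); rewrite /= adjE.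
- by apply: (inj_e _ _ (svalP X')); rewrite /= adjE [RHS]compA adjE.
- by apply: (inj_e _ _ (svalP X)); rewrite /= adjE [RHS]compA rmE -compA adjE.
Qed.

(** By naturality in the second variable the adjunction bijection is precomposition
    with the unit, so bijectivity says exactly that the unit is a reflection. *)
Lemma left_adjoint_unit P (L : functor C (full_subcategory P)) :
  adjoint L (inclusion P) ->
  exists e : forall X, hom X (sval (L X)),
    (forall X, is_reflection P (e X)) /\
    (forall X X' (u : hom X X'),
       (fmap L u : hom (sval (L X)) (sval (L X'))) \oc e X = e X' \oc u).
Proof.
move=> [phi [bij_phi phi_l phi_r]].
exists (fun X => phi X (L X) (idm (L X))); split=> [X|X X' u].
  split=> [|W PW]; first exact: svalP (L X).
  apply: (eq_bij (bij_phi X (exist P W PW))) => u.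
  by rewrite -[RHS](phi_r X _ (exist P W PW) u) [in RHS]compm1.
by rewrite -phi_l -[LHS]phi_r compm1 comp1m.
Qed.

(** The counit is the preimage of the identity under the adjunction bijection, whose
    inverse is therefore composition with the counit. *)
Lemma right_adjoint_counit S (R : functor C (full_subcategory S)) :
  adjoint (inclusion S) R ->
  exists e : forall Y, hom (sval (R Y)) Y,
    (forall Y, is_coreflection S (e Y)) /\
    (forall Y Y' (u : hom Y Y'),
       e Y' \oc (fmap R u : hom (sval (R Y)) (sval (R Y'))) = u \oc e Y).
Proof.
move=> [phi [bij_phi phi_l phi_r]].
have surj_phi X Y (v : hom X (R Y)) : exists u, phi X Y u = v.
  by have [phi' _ phiK] := bij_phi X Y; exists (phi' v).
pose e Y : hom (sval (R Y)) Y := projT1 (cid (surj_phi (R Y) Y (idm (R Y)))).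
have phi_e Y : phi (R Y) Y (e Y) = idm (R Y).
  exact: projT2 (cid (surj_phi (R Y) Y (idm (R Y)))).
have phi_eM (X : full_subcategory S) Y (u : hom X (R Y)) :
    phi X Y (e Y \oc (u : hom (sval X) (sval (R Y)))) = u.
  by rewrite [LHS](phi_l _ _ _ u) phi_e comp1m.
exists e; split=> [Y|Y Y' u].
  split=> [|W SW]; first exact: svalP (R Y).
  pose W' : full_subcategory S := exist S W SW.
  by have [phi' phi'K _] := bij_phi W' Y; exists (phi W' Y) => u;
     [exact: (phi_eM W') | apply: (bij_inj (bij_phi W' Y)); exact: (phi_eM W')].
by apply: (bij_inj (bij_phi _ _)); rewrite /= phi_eM phi_r phi_e compm1.
Qed.

(** An arrow [X -> Y] of this kind, with [X] in [S] and [Y] in [P], makes [X] represent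
    maps from [S] to [Y] and [Y] represent maps from [X] to [P]. *)
Definition is_correspondence S P (X Y : C) (f : hom X Y) : Prop :=
  is_coreflection S f /\ is_reflection P f.

(** By uniqueness of universal arrows, the unit [e X] at [X] in [S] differs from a
    correspondence by an isomorphism, so it is itself a coreflection. Full
    faithfulness compares Hom(X, X') -> Hom(X, L X') <- Hom(L X, L X'), where both
    maps are bijective; essential surjectivity is uniqueness of reflections. *)
Lemma correspondence_left_equivalence S P (L : functor C (full_subcategory P)) :
  adjoint L (inclusion P) ->
  (forall X, S X -> exists Y (f : hom X Y), is_correspondence S P f) ->
  (forall Y, P Y -> exists X (f : hom X Y), is_correspondence S P f) ->
  is_equivalence (functor_comp L (inclusion S)).
Proof.
move=> /left_adjoint_unit[e [refl_e e_nat]] from_S to_P.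
have corefl_e X : S X -> is_coreflection S (e X).
  move=> SX; have [Y [f [corefl_f refl_f]]] := from_S _ SX.
  have [s iso_s sfE] := reflection_unique refl_f (refl_e X).
  split=> // W SW; apply: (eq_bij (bij_comp (iso_postcomp_bij W iso_s) (corefl_f.2 _ SW))).
  by move=> u /=; rewrite compA sfE.
apply: fully_faithful_equivalence => [X X'|Y].
  apply: (bij_cancel ((refl_e (sval X)).2 _ (svalP (L (sval X')))))
         ((corefl_e _ (svalP X')).2 _ (svalP X)) _.
  by move=> u /=; rewrite e_nat.
have [X [f [[SX _] refl_f]]] := to_P _ (svalP Y).
have [s iso_s _] := reflection_unique (refl_e X) refl_f.
by exists (exist S X SX), s.
Qed.

(** Dual: the counit at [Y] in [P] is also a reflection, and the comparison is
    Hom(Y, Y') -> Hom(R Y, Y') <- Hom(R Y, R Y'). *)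
Lemma correspondence_right_equivalence S P (R : functor C (full_subcategory S)) :
  adjoint (inclusion S) R ->
  (forall X, S X -> exists Y (f : hom X Y), is_correspondence S P f) ->
  (forall Y, P Y -> exists X (f : hom X Y), is_correspondence S P f) ->
  is_equivalence (functor_comp R (inclusion P)).
Proof.
move=> /right_adjoint_counit[e [corefl_e e_nat]] from_S to_P.
have refl_e Y : P Y -> is_reflection P (e Y).
  move=> PY; have [X [f [corefl_f refl_f]]] := to_P _ PY.
  have [s iso_s fsE] := coreflection_unique (corefl_e Y) corefl_f.
  split=> // W PW; apply: (eq_bij (bij_comp (iso_precomp_bij W iso_s) (refl_f.2 _ PW))).
  by move=> u /=; rewrite -compA fsE.
apply: fully_faithful_equivalence => [Y Y'|X].
  apply: (bij_cancel ((corefl_e (sval Y')).2 _ (svalP (R (sval Y)))))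
         ((refl_e _ (svalP Y)).2 _ (svalP Y')) _.
  by move=> u /=; rewrite e_nat.
have [Y [f [corefl_f [PY _]]]] := from_S _ (svalP X).
have [s iso_s _] := coreflection_unique (corefl_e Y) corefl_f.
by exists (exist P Y PY), s.
Qed.

End Reflections.

(** * Triangles whose cone is orthogonal to a subcategory *)

Section Triangles.

Variable T : triangulated_category.
Implicit Types P Q S : T -> Prop.

Lemma zero_object_shift (Z : T) : is_zero_object Z -> is_zero_object (shift Z).
Proof.
move=> zZ.
have id0 : idm (shift Z) = 0.
  by rewrite -fmap1 (zero_object_eq (idm Z) 0 zZ) fmap0.
move=> X; split=> f; first by rewrite -(comp1m f) id0 comp0m.
by rewrite -(compm1 f) id0 compm0.
Qed.

(** Exactness of Hom(W, -): compare the rotated triangles W -> 0 -> W[1] and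
    Y -> Z -> X[1] along [u]; the arrow W[1] -> X[1] supplied by the third axiom
    is a shift, because the shift is full. *)
Lemma dist_weak_kernel (X Y Z W : T) (f : hom X Y) (g : hom Y Z)
    (h : hom Z (shift X)) (u : hom W Y) :
  dist f g h -> g \oc u = 0 -> exists v : hom W X, u = f \oc v.
Proof.
move=> tri gu0; have [Z0 zZ0] := has_zero_object T.
have /dist_rotate tri' := tri; have /dist_rotate tri0 := dist_id W zZ0.
have [|c [_]] := dist_fill tri0 tri' (a := u) (b := 0); first by rewrite comp0m gu0.
have [v <-] := equivalence_full (shift_equivalence T) c.
rewrite fmap1 compmN compm1 compNm -fmap_comp => /oppr_inj cE.
by exists v; apply: (equivalence_faithful (shift_equivalence T)).
Qed.

(** Exactness of Hom(-, W): compare the triangle with 0 -> W -> W along [u]. *)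
Lemma dist_weak_cokernel (X Y Z W : T) (f : hom X Y) (g : hom Y Z)
    (h : hom Z (shift X)) (u : hom Y W) :
  dist f g h -> u \oc f = 0 -> exists v : hom Z W, u = v \oc g.
Proof.
move=> tri uf0; have [Z0 zZ0] := has_zero_object T.
have tri0 : dist (0 : hom Z0 W) (idm W) 0.
  apply/dist_rotate; rewrite fmap0 oppr0.
  exact: dist_id (zero_object_shift zZ0).
have [|v [vE _]] := dist_fill tri tri0 (a := 0) (b := u).
  by rewrite uf0 compm0.
by exists v; rewrite vE comp1m.
Qed.

(** The kernel and cokernel of Hom(W, X) -> Hom(W, Y) are controlled by
    Hom(W, Z[-1]) and Hom(W, Z). The first is read as Hom(W[1], Z), which
    vanishes because [S] is closed under the shift. *)
Lemma cone_coreflection S Q (X Y Z : T) (f : hom X Y) (g : hom Y Z)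
    (h : hom Z (shift X)) :
  is_triangulated_subcategory S ->
  (forall V W : T, S V -> Q W -> forall u : hom V W, u = 0) ->
  dist f g h -> S X -> Q Z -> is_coreflection S f.
Proof.
move=> triS SQ tri SX QZ; split=> // W SW; apply: inj_surj_bij => [u v|u].
  move=> /= /eqP; rewrite -subr_eq0 => /eqP fuv; apply/eqP; rewrite -subr_eq0.
  have {}fuv : f \oc (u - v) = 0 by rewrite compDr compmN.
  move: (u - v) fuv => {u v}w fw0; apply/eqP.
  apply: (equivalence_faithful (shift_equivalence T)); rewrite fmap0.
  have /dist_rotate/dist_rotate tri' := tri.
  have [|v ->] := dist_weak_kernel (u := fmap shift w) tri'.
    by rewrite compNm -fmap_comp fw0 fmap0 oppr0.
  by rewrite (SQ (shift W) Z ((sub_shift triS W).1 SW) QZ v) compm0.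
by have [|v ->] := dist_weak_kernel (u := u) tri; [exact: (SQ W Z) | exists v].
Qed.

(** Dually, Hom(Y, W) -> Hom(X, W) is controlled by Hom(Z, W) and Hom(Z, W[1]). *)
Lemma cone_reflection P Q (X Y Z : T) (f : hom X Y) (g : hom Y Z)
    (h : hom Z (shift X)) :
  is_triangulated_subcategory P ->
  (forall V W : T, Q V -> P W -> forall u : hom V W, u = 0) ->
  dist f g h -> P Y -> Q Z -> is_reflection P f.
Proof.
move=> triP QP tri PY QZ; split=> // W PW; apply: inj_surj_bij => [u v|u].
  move=> /= /eqP; rewrite -subr_eq0 => /eqP fuv; apply/eqP; rewrite -subr_eq0.
  have {}fuv : (u - v) \oc f = 0 by rewrite compDl compNm.
  have [w ->] := dist_weak_cokernel tri fuv.
  by rewrite (QP Z W QZ PW w) comp0m.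
have /dist_rotate/dist_rotate tri' := tri.
have PW1 : P (shift W) := (sub_shift triP W).1 PW.
have [|v] := dist_weak_cokernel (u := fmap shift u) tri'; first exact: (QP Z (shift W)).
have [w <-] := equivalence_full (shift_equivalence T) v => uE.
exists (- w); rewrite compNm; apply: (equivalence_faithful (shift_equivalence T)).
by rewrite fmapN uE compmN fmap_comp.
Qed.

(** * Semi-orthogonal decompositions and mutation *)

(** In the triangle Y -> X -> Z of the decomposition, Y -> X has cone in [P]. *)
Lemma sod_right_adjoint P Q :
  semiorthogonal_decomposition P Q ->
  has_right_adjoint (inclusion Q).
Proof.
case=> _ triQ PQ tri; apply: coreflections_right_adjoint => X.
have [Y [Z [f [g [h [QY PZ tri_fgh]]]]]] := tri X.
by exists Y, f; apply: cone_coreflection tri_fgh QY PZ.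
Qed.

(** In the triangle Y -> X -> Z of the decomposition, X -> Z has cone Y[1] in [Q]. *)
Lemma sod_left_adjoint P Q :
  semiorthogonal_decomposition P Q ->
  has_left_adjoint (inclusion P).
Proof.
case=> triP triQ PQ tri; apply: reflections_left_adjoint => X.
have [Y [Z [f [g [h [QY PZ /dist_rotate tri_fgh]]]]]] := tri X.
exists Z, g; apply: cone_reflection tri_fgh PZ ((sub_shift triQ Y).1 QY) => //.
Qed.

(** If X is left orthogonal to [P], the map X -> Z in its triangle Y -> X -> Z is
    zero, so the identity of Z factors through Y[1] -> Z, which is zero by
    orthogonality. Hence Z = 0 and X is isomorphic to Y. *)
Lemma sod_left_orthogonal P Q :
  semiorthogonal_decomposition P Q -> left_orthogonal P = Q.
Proof.
case=> triP triQ PQ tri; apply/funext => X; apply/propext; split; last first.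
  by move=> QX Y; exact: PQ.
move=> X_orth; have [Y [Z [f [g [h [QY PZ tri_fgh]]]]]] := tri X.
have idZ0 : idm Z = 0.
  have /dist_rotate tri_ghf := tri_fgh.
  have [|v ->] := dist_weak_cokernel (u := idm Z) tri_ghf.
    by rewrite comp1m; exact: X_orth PZ g.
  by rewrite (PQ _ Z ((sub_shift triQ Y).1 QY) PZ v) comp0m.
have zZ : is_zero_object Z.
  move=> W; split=> u; first by rewrite -(comp1m u) idZ0 comp0m.
  by rewrite -(compm1 u) idZ0 compm0.
(* A zero object is the cone of any identity. *)
have QZ : Q Z := sub_cone triQ (dist_id Y zZ) QY QY.
have /dist_rotate/dist_rotate tri_hfg := tri_fgh.
by apply/(sub_shift triQ); apply: sub_cone tri_hfg QZ ((sub_shift triQ Y).1 QY).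
Qed.

(** Two adjacent decompositions T = <P, Q> = <Q, S>. *)

Section Mutation.

Variables P Q S : T -> Prop.
Hypotheses (hPQ : semiorthogonal_decomposition P Q)
           (hQS : semiorthogonal_decomposition Q S).

Lemma mutation_correspondence X Y Z (f : hom X Y) (g : hom Y Z) h :
  dist f g h -> S X -> P Y -> Q Z -> is_correspondence S P f.
Proof.
move=> tri SX PY QZ; split.
  by apply: cone_coreflection (sod_right hQS) (sod_orthogonal hQS) tri SX QZ.
by apply: cone_reflection (sod_left hPQ) (sod_orthogonal hPQ) tri PY QZ.
Qed.

Lemma mutation_source X :
  S X -> exists Y (f : hom X Y), is_correspondence S P f.
Proof.
move=> SX; have [Q0 [Y [f [g [h [QQ PY /dist_rotate tri]]]]]] := sod_triangle hPQ X.
exists Y, g; apply: mutation_correspondence tri SX PY _.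
exact: (sub_shift (sod_right hPQ) Q0).1.
Qed.

Lemma mutation_target Y :
  P Y -> exists X (f : hom X Y), is_correspondence S P f.
Proof.
move=> PY; have [X [Z [f [g [h [SX QZ tri]]]]]] := sod_triangle hQS Y.
by exists X, f; apply: mutation_correspondence tri SX PY QZ.
Qed.

Lemma mutation_left_equivalence : left_composite_equivalence P S.
Proof.
move=> L adjL; apply: correspondence_left_equivalence adjL _ _.
- exact: mutation_source.
- exact: mutation_target.
Qed.

Lemma mutation_right_equivalence : right_composite_equivalence S P.
Proof.
move=> R adjR; apply: correspondence_right_equivalence adjR _ _.
- exact: mutation_source.
- exact: mutation_target.
Qed.

End Mutation.

End Triangles.

(** * Four-periodic decompositions *)

Lemma four_periodic_spherical_pair (T : triangulated_category) (A B C D : T -> Prop) :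
  semiorthogonal_decomposition A B -> semiorthogonal_decomposition B C ->
  semiorthogonal_decomposition C D -> semiorthogonal_decomposition D A ->
  spherical_pair A C.
Proof.
move=> hAB hBC hCD hDA.
split; rewrite ?(sod_left_orthogonal hAB) ?(sod_left_orthogonal hCD).
- by split; [exact: sod_left hAB | exact: sod_left_adjoint hAB | exact: sod_right_adjoint hDA].
- by split; [exact: sod_left hCD | exact: sod_left_adjoint hCD | exact: sod_right_adjoint hBC].
- exact: sod_right_adjoint hAB.
- exact: sod_right_adjoint hCD.
- exact: mutation_left_equivalence hAB hBC.
- exact: mutation_left_equivalence hCD hDA.
- exact: mutation_right_equivalence hDA hAB.
- exact: mutation_right_equivalence hBC hCD.
Qed.

Theorem propositionB3 (T : triangulated_category) (A B C D : T -> Prop)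
    (hAB : semiorthogonal_decomposition A B)
    (hBC : semiorthogonal_decomposition B C)
    (hCD : semiorthogonal_decomposition C D)
    (hDA : semiorthogonal_decomposition D A) :
  spherical_pair A C /\ spherical_pair B D.
Proof.
split; first exact: four_periodic_spherical_pair hAB hBC hCD hDA.
exact: four_periodic_spherical_pair hBC hCD hDA hAB.
Qed.
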